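(* Let $p,q$ be positive integers. The minimal $H$-representation of the polytope of convex discrete quasi-copulas $\mathrm{CDQ}_{p,q}$ consists of the $2[(p-1)(q-1)+1]$ inequalities \begin{enumerate} \item[(v1)] $x_{11}\ge 0$ and $x_{p-1,q-1}\ge\frac{(p-1)(q-1)-1}{pq}$; \item[(v3a)] $x_{ij}+x_{i,j+2}-2x_{i,j+1}\ge 0$ for all $i\in\{1,\dots,p-1\}$, $j\in\{0,\dots,q-2\}$; \item[(v3b)] $x_{ij}+x_{i+2,j}-2x_{i+1,j}\ge 0$ for all $j\in\{1,\dots,q-1\}$, $i\in\{0,\dots,p-2\}$. \end{enumerate}
   Context: Matrices in $\mathbb{R}^{(p+1)\times(q+1)}$ have rows indexed by $0,\dots,p$ and columns indexed by $0,\dots,q$. The polytope of discrete quasi-copulas $\mathrm{DQ}_{p,q}$ is the set of all $[c_{ij}]\in\mathbb{R}^{(p+1)\times(q+1)}$ such that (q1) $c_{0j}=0$, $c_{pj}=\frac{j}{q}$, $c_{i0}=0$, $c_{iq}=\frac{i}{p}$ for all $0\le i\le p$, $0\le j\le q$; (q2a) $0\le c_{i+1,j}-c_{ij}\le\frac1p$ for all $0\le i\le p-1$, $1\le j\le q$; (q2b) $0\le c_{i,j+1}-c_{ij}\le\frac1q$ for all $1\le i\le p$, $0\le j\le q-1$. The polytope of convex discrete quasi-copulas $\mathrm{CDQ}_{p,q}$ is the set of all $[c_{ij}]\in\mathrm{DQ}_{p,q}$ that in addition satisfy $2c_{ij}\le c_{i-1,j}+c_{i+1,j}$ and $2c_{ij}\le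 c_{i,j-1}+c_{i,j+1}$ for all $1\le i\le p-1$, $1\le j\le q-1$. An $H$-representation of a polytope is a collection of affine inequalities defining it; the minimal $H$-representation is the unique irredundant one, and its size is the number of facets. Here the polytope is regarded inside the affine space cut out by the boundary equalities (q1): a matrix $[x_{ij}]$ satisfying (q1) lies in the polytope if and only if it satisfies all the inequalities of the $H$-representation, and irredundant means that for each inequality there is a matrix satisfying (q1) and all the other inequalities but violating that one.
   Formalization: Minimality (irredundancy) is claimed only for p,q ≥ 3; it fails if p ≤ 2 or q ≤ 2 (e.g. for p=q=2 both inequalities (v1) read x_11 ≥ 0; for p=2, q ≥ 3, (v3a) implies (v3b)). That the inequalities define the polytope, and their number, are stated for all positive p,q. *)

(* Defs.v *)
From HB Require Import structures.
From mathcomp Require Import all_boot all_order all_algebra.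

Set Implicit Arguments.
Unset Strict Implicit.
Unset Printing Implicit Defensive.

Import Order.TTheory GRing.Theory Num.Theory.
Local Open Scope ring_scope.

(* [entry X i j] is the entry x_{ij}, for natural numbers i <= p and j <= q.
   Outside this range [inord] returns index 0; every use below is in range. *)
Definition entry (R : Type) (p q : nat) (X : 'M[R]_(p.+1, q.+1)) (i j : nat)
  : R := X (inord i) (inord j).

Section Polytopes.
Variables (R : realFieldType) (p q : nat).
Implicit Type X : 'M[R]_(p.+1, q.+1).

Definition boundary X : Prop :=
  forall i j : nat, (i <= p)%N -> (j <= q)%N ->
    [/\ entry X 0 j = 0, entry X p j = j%:R / q%:R,
        entry X i 0 = 0 & entry X i q = i%:R / p%:R].

Definition increments_in_i X : Prop :=
  forall i j : nat, (i < p)%N -> (1 <= j <= q)%N ->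
    0 <= entry X i.+1 j - entry X i j <= 1 / p%:R.

Definition increments_in_j X : Prop :=
  forall i j : nat, (1 <= i <= p)%N -> (j < q)%N ->
    0 <= entry X i j.+1 - entry X i j <= 1 / q%:R.

Definition DQ X : Prop :=
  [/\ boundary X, increments_in_i X & increments_in_j X].

Definition CDQ X : Prop :=
  DQ X /\
  forall i j : nat, (1 <= i <= p.-1)%N -> (1 <= j <= q.-1)%N ->
    2 * entry X i j <= entry X i.-1 j + entry X i.+1 j /\
    2 * entry X i j <= entry X i j.-1 + entry X i j.+1.

End Polytopes.

Section HRepresentation.
Variables (R : realFieldType) (m n : nat).

(* The pair (f, b) stands for the inequality f X >= b. *)
Definition inequality : Type := (('M[R]_(m, n) -> R) * R)%type.

Definition satisfies (X : 'M[R]_(m, n)) (h : inequality) : Prop :=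
  h.2 <= h.1 X.

(* S is the ambient affine space. *)
Definition H_representation (S P : 'M[R]_(m, n) -> Prop)
    (I : finType) (h : I -> inequality) : Prop :=
  (forall k, scalar (h k).1) /\
  (forall X, S X -> (P X <-> forall k, satisfies X (h k))).

Definition irredundant (S : 'M[R]_(m, n) -> Prop)
    (I : finType) (h : I -> inequality) : Prop :=
  forall k, exists X,
    [/\ S X, forall l, l != k -> satisfies X (h l) & ~ satisfies X (h k)].

End HRepresentation.

(* The booleans index the two corner inequalities; the two copies of
   'I_p.-1 * 'I_q.-1 index convexity along rows and along columns. *)
Definition v_index (p q : nat) : finType :=
  (bool + ('I_p.-1 * 'I_q.-1 + 'I_p.-1 * 'I_q.-1))%type.

(* The ordinals i < p - 1 and j < q - 1 start at 0: an index ranging over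
   {1, ..., p - 1}, resp. {1, ..., q - 1}, is written i.+1, resp. j.+1, and an
   index ranging over {0, ..., p - 2}, resp. {0, ..., q - 2}, is i, resp. j.
   The family is redundant when p <= 2 or q <= 2: for p = 1 the boundary
   conditions fix X; for p = q = 2 the inequalities coincide in pairs; for
   p = 2 < q convexity of row 1, with end values 0 and 1/2, already gives the
   column inequalities 2 x_{1j} <= j/q. *)
Definition v_inequality (R : realFieldType) (p q : nat) (k : v_index p q)
  : inequality R p.+1 q.+1 :=
  match k with
  | inl true => (fun X => entry X 1 1, 0)
  | inl false =>
      (fun X => entry X p.-1 q.-1,
       ((p.-1)%:R * (q.-1)%:R - 1) / (p%:R * q%:R))
  | inr (inl (i, j)) =>
      (fun X => entry X i.+1 j + entry X i.+1 j.+2 - 2 * entry X i.+1 j.+1, 0)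
  | inr (inr (i, j)) =>
      (fun X => entry X i j.+1 + entry X i.+2 j.+1 - 2 * entry X i.+1 j.+1, 0)
  end.

(* Main.v *)
(** Along a convex sequence the increments are monotone, so bounds on the first
    and on the last increment bound them all. Applied to row 1 and row p-1, and
    then to every column, this shows that the two corner inequalities and
    convexity imply all increment bounds.
    For irredundancy, perturb the product ij/(pq), all of whose second
    differences vanish, by minus a product of two tent functions: this is
    convex, and with both apexes near a corner it violates the inequality at
    that corner. To violate convexity of row a at c only, put the apexes at a
    and b <> c, and raise the entry (a, c) by exactly as much as the kink of
    the column at a allows. *)
Require Import Defs.
From mathcomp Require Import all_boot all_order all_algebra.
From mathcomp Require Import zify ring lra.

Set Implicit Arguments.
Unset Strict Implicit.
Unset Printing Implicit Defensive.

Import Order.TTheory GRing.Theory Num.Theory.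
Local Open Scope ring_scope.

(** * Increments of convex sequences *)

Section ConvexSequences.
Variables (R : realFieldType) (n : nat) (u : nat -> R).

Definition convex_seq := forall i, (i.+2 <= n)%N -> 0 <= u i + u i.+2 - 2 * u i.+1.

Lemma convex_seq_increments (cu : convex_seq) i j :
  (i <= j < n)%N -> u i.+1 - u i <= u j.+1 - u j.
Proof.
move=> /andP[]; elim: j => [|j IHj]; first by rewrite leqn0 => /eqP->.
rewrite leq_eqVlt => /orP[/eqP-> //|lt_ij lt_jn].
have := IHj lt_ij (ltnW lt_jn); have := cu j lt_jn; lra.
Qed.

Lemma convex_seq_ge0 (cu : convex_seq) i :
  u 0%N = 0 -> 0 <= u 1%N -> (i <= n)%N -> 0 <= u i.
Proof.
move=> u0 u1; elim: i => [|i IHi] le_in; first by rewrite u0.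
have := IHi (ltnW le_in).
have := @convex_seq_increments cu 0 i; rewrite le_in u0 => /(_ isT); lra.
Qed.

(** The left-hand side is the sum of the last [m] increments, each at most the final one and hence
    at most [c]. *)
Lemma convex_seq_last (cu : convex_seq) c m :
  u n - u n.-1 <= c -> (m <= n)%N -> u n - u (n - m)%N <= m%:R * c.
Proof.
move=> uc; elim: m => [|m IHm] lt_mn; first by rewrite subn0 subrr mul0r.
have := IHm (ltnW lt_mn).
have := @convex_seq_increments cu (n - m.+1)%N n.-1 ltac:(lia).
rewrite prednK ?(leq_trans _ lt_mn) // subnSK // -natr1; lra.
Qed.

End ConvexSequences.

(** * From corner inequalities and convexity to increment bounds *)

Definition quasi_copula_boundary (R : realFieldType) (p q : nat)
    (x : nat -> nat -> R) :=
  forall i j : nat, (i <= p)%N -> (j <= q)%N ->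
    [/\ x 0%N j = 0, x p j = j%:R / q%:R, x i 0%N = 0 & x i q = i%:R / p%:R].

Lemma quasi_copula_boundary_swap (R : realFieldType) (p q : nat)
    (x : nat -> nat -> R) :
  quasi_copula_boundary p q x -> quasi_copula_boundary q p (fun i j => x j i).
Proof. by move=> bx i j le_i le_j; case: (bx j i le_j le_i). Qed.

Lemma natr_predV (R : realFieldType) (n : nat) :
  (0 < n)%N -> (n.-1)%:R / n%:R = 1 - n%:R^-1 :> R.
Proof.
move=> n0; rewrite -subn1 natrB // mulrBl mul1r divff //.
by rewrite pnatr_eq0 -lt0n.
Qed.

(** Since row [p-1] ends at 1 - 1/p, this form turns the corner inequality into the bound 1/q on the
    last increment of that row. *)
Lemma corner_thresholdE (R : realFieldType) (p q : nat) :
  (0 < p)%N -> (0 < q)%N ->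
  ((p.-1)%:R * (q.-1)%:R - 1) / (p%:R * q%:R) =
    1 - p%:R^-1 - q%:R^-1 :> R.
Proof.
move=> p0 q0; rewrite mulrBl -mulf_div !natr_predV // mul1r invfM; ring.
Qed.

(** Treating increments in [i] suffices: the hypotheses are symmetric, so those in [j] come from the
    function with swapped arguments. *)
Lemma convex_increments (R : realFieldType) (p q : nat) (x : nat -> nat -> R) :
  (0 < p)%N -> (0 < q)%N -> quasi_copula_boundary p q x ->
  (forall i, (0 < i < p)%N -> convex_seq q (x i)) ->
  (forall j, (0 < j < q)%N -> convex_seq p (x^~ j)) ->
  0 <= x 1%N 1%N ->
  ((p.-1)%:R * (q.-1)%:R - 1) / (p%:R * q%:R) <= x p.-1 q.-1 ->
  forall i j, (i < p)%N -> (1 <= j <= q)%N ->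
    0 <= x i.+1 j - x i j <= 1 / p%:R.
Proof.
move=> p0 q0 bx rows cols x11; rewrite corner_thresholdE // => xlast i j lt_ip.
case/andP=> j0; rewrite leq_eqVlt => /orP[/eqP->|lt_jq].
  have [_ _ _ ->] := bx i q (ltnW lt_ip) (leqnn q).
  have [_ _ _ ->] := bx i.+1 q lt_ip (leqnn q).
  by rewrite -mulrBl -natr1 [_ + 1]addrC addrK lexx divr_ge0 ?ler0n.
have qR0 : (0 : R) < q%:R by rewrite ltr0n.
have pR0 : (0 : R) < p%:R by rewrite ltr0n.
have [x0j xpj _ _] := bx 0 j (leq0n _) (ltnW lt_jq).
(* For [p = 1] there is no interior row; the single increment is j/q, at most 1. *)
have [p1|p_neq1] := eqVneq p 1%N.
  have i0 : i = 0%N by lia.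
  move: xpj; rewrite p1 i0 x0j => ->.
  by rewrite subr0 divr1 divr_ge0 ?ler0n // ler_pdivrMr // mul1r ler_nat ltnW.
have p1 : (1 < p)%N by lia.
have cj : convex_seq p (x^~ j) by apply: cols; lia.
(* Row 1 is convex, starts at 0, and has first increment [x 1 1]. *)
have first_ge0 : 0 <= x 1%N j.
  have [_ _ x10 _] := bx 1 0 p0 (leq0n _).
  by apply: (@convex_seq_ge0 _ q) => //; [apply: rows; lia | lia].
(* Going back [q - j] steps of size at most 1/q from the end of row [p-1] gives x_{p-1,j} >= 1 - 1/p
   - (q-j)/q = j/q - 1/p. *)
have last_le : x p j - x p.-1 j <= 1 / p%:R.
  have [_ _ _ xlq] := bx p.-1 q (leq_pred p) (leqnn q).
  have cp : convex_seq q (x p.-1) by apply: rows; lia.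
  have := @convex_seq_last _ _ _ cp q%:R^-1 (q - j)%N.
  rewrite subKn ?(ltnW lt_jq) // leq_subr xlq natr_predV // xpj.
  rewrite natrB ?(ltnW lt_jq) // mulrBl divff ?lt0r_neq0 // => h.
  have := h ltac:(lra) isT; lra.
have := @convex_seq_increments _ _ _ cj 0 i lt_ip.
have := @convex_seq_increments _ _ _ cj i p.-1 ltac:(lia).
rewrite prednK // x0j; lra.
Qed.

(** * The inequalities describe the polytope *)

Lemma scalar_entry (R : realFieldType) (p q i j : nat) :
  scalar (fun X : 'M[R]_(p.+1, q.+1) => entry X i j).
Proof. by move=> a X Y; rewrite /entry !mxE. Qed.

Lemma scalar_second_difference (R : realFieldType) (m n : nat)
    (f g h : 'M[R]_(m, n) -> R) :
  scalar f -> scalar g -> scalar h -> scalar (fun X => f X + g X - 2 * h X).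
Proof. by move=> sf sg sh a X Y; rewrite sf sg sh /=; ring. Qed.

Lemma scalar_v_inequality (R : realFieldType) (p q : nat) (k : v_index p q) :
  scalar (v_inequality R k).1.
Proof.
by move: k => [[]|[[i j]|[i j]]] /=;
  do ?[exact: scalar_entry | apply: scalar_second_difference].
Qed.

Lemma v_inequalityP (R : realFieldType) (p q : nat)
    (X : 'M[R]_(p.+1, q.+1)) :
  (forall k : v_index p q, satisfies X (v_inequality R k)) <->
  [/\ 0 <= entry X 1 1,
      ((p.-1)%:R * (q.-1)%:R - 1) / (p%:R * q%:R) <= entry X p.-1 q.-1,
      forall i, (0 < i < p)%N -> convex_seq q (entry X i) &
      forall j, (0 < j < q)%N -> convex_seq p ((entry X)^~ j)].
Proof.
split=> [sat|[x11 xlast rows cols]].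
  split; [exact: (sat (inl true)) | exact: (sat (inl false)) | |].
  - move=> [|i] //= lt_ip j lt_jq.
    have lt_i : (i < p.-1)%N by lia.
    have lt_j : (j < q.-1)%N by lia.
    exact: (sat (inr (inl (Ordinal lt_i, Ordinal lt_j)))).
  - move=> [|j] //= lt_jq i lt_ip.
    have lt_i : (i < p.-1)%N by lia.
    have lt_j : (j < q.-1)%N by lia.
    exact: (sat (inr (inr (Ordinal lt_i, Ordinal lt_j)))).
move=> [[]|[[i j]|[i j]]] //; rewrite /satisfies /=; have ? := ltn_ord i;
  have ? := ltn_ord j.
  by apply: rows; lia.
by apply: (cols j.+1); lia.
Qed.

Lemma H_representation_CDQ (R : realFieldType) (p q : nat) :
  (0 < p)%N -> (0 < q)%N ->
  H_representation (@boundary R p q) (@CDQ R p q) (@v_inequality R p q).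
Proof.
move=> p0 q0; split; first exact: scalar_v_inequality.
move=> X bX; rewrite v_inequalityP.
have pR0 : (0 : R) < p%:R by rewrite ltr0n.
have qR0 : (0 : R) < q%:R by rewrite ltr0n.
split=> [[[_ incri incrj] convex]|[x11 xlast rows cols]]; last first.
  split.
    split=> // [|i j i1 lt_jq].
      exact: (convex_increments p0 q0 bX rows cols x11 xlast).
    apply: (convex_increments q0 p0 (quasi_copula_boundary_swap bX)) => //.
    by rewrite [_ * (p.-1)%:R]mulrC [q%:R * _]mulrC.
  move=> [|i] [|j] //= lt_i lt_j; split.
    have := cols j.+1 _ i _ => /(_ ltac:(lia) ltac:(lia)); lra.
  have := rows i.+1 _ j _ => /(_ ltac:(lia) ltac:(lia)); lra.
split.
- have [x01 _ _ _] := bX 0 1 (leq0n _) q0.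
  by have := incri 0 1 p0 q0; rewrite x01; lra.
(* For [q = 1] the corner lies in column 0, outside the range of [incri]; its value is 0 and the
   threshold is -1/p. Otherwise the last increment of column [q-1], which ends at 1 - 1/q, is at
   most 1/p. *)
- rewrite corner_thresholdE //; have [q1|q_neq1] := eqVneq q 1%N.
    have [_ _ + _] := bX p.-1 0 (leq_pred p) (leq0n _).
    have -> : q.-1 = 0%N by rewrite q1.
    have -> : q%:R = 1 :> R by rewrite q1.
    move=> ->; rewrite invr1.
    by have := invr_gt0 (p%:R : R); rewrite pR0; lra.
  have [_ xp _ _] := bX 0 q.-1 (leq0n _) (leq_pred q).
  have := incri p.-1 q.-1; rewrite prednK // xp natr_predV //.
  by move=> /(_ ltac:(lia) ltac:(lia)); lra.
- move=> [|i] // lt_i j lt_j.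
  by have := convex i.+1 j.+1 => /(_ ltac:(lia) ltac:(lia)) [_ /=]; lra.
move=> [|j] // lt_j i lt_i.
by have := convex i.+1 j.+1 => /(_ ltac:(lia) ltac:(lia)) [/= + _]; lra.
Qed.

(** * Tent functions and the perturbed product *)

(** This is [n] times the Green function of the discrete Dirichlet Laplacian on 0..n with pole [a];
    the factor keeps the values natural. *)
Definition tent (n a i : nat) : nat :=
  if (i <= a)%N then (i * (n - a))%N else (a * (n - i))%N.

Lemma tent0 n a : tent n a 0 = 0%N.
Proof. by []. Qed.

Lemma tent_end n a : (a < n)%N -> tent n a n = 0%N.
Proof. by move=> lt_an; rewrite /tent leqNgt lt_an subnn muln0. Qed.

Lemma tent_apex n a : tent n a a = (a * (n - a))%N.
Proof. by rewrite /tent leqnn. Qed.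

Lemma tent_gt0 n a i : (0 < a < n)%N -> (0 < i < n)%N -> (0 < tent n a i)%N.
Proof. by rewrite /tent; case: ifP; nia. Qed.

Lemma tent_le n a i : (i <= n)%N -> (tent n a i <= n * n)%N.
Proof. by rewrite /tent; case: ifP; nia. Qed.

Lemma tent_second_difference (R : realFieldType) n a i :
  (a < n)%N -> (i.+2 <= n)%N ->
  (tent n a i)%:R + (tent n a i.+2)%:R - 2 * (tent n a i.+1)%:R =
    - (n * (i.+1 == a))%:R :> R.
Proof.
move=> lt_an lt_in.
(* The identity is first proved in [nat], with the negative terms moved across because subtraction
   truncates there. *)
have /(congr1 (fun m => m%:R : R)) :
    (tent n a i + tent n a i.+2 + n * (i.+1 == a) = 2 * tent n a i.+1)%N.
  rewrite /tent; case: (ltngtP i.+1 a) => [lt_ia|lt_ai|eq_ia].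
  - have -> : (i <= a)%N by lia.
    nia.
  - case: leqP => [le_ia|?]; last nia.
    have -> : i = a by lia.
    nia.
  have -> : (i <= a)%N by lia.
  nia.
by rewrite /= !natrD; lra.
Qed.

(* In column c, - K tent tent has second difference K p t(c) at a, where t is the
   tent in the column index. Raising the entry (a, c) by half of it, times e,
   subtracts e K p t(c), so the column stays convex as long as e <= 1. *)
Definition tent_bump (R : realFieldType) (p q a b c : nat) (K e : R)
    (i j : nat) : R :=
  (i%:R * j%:R - K * (tent p a i)%:R * (tent q b j)%:R
   + e * ((K * p%:R * (tent q b c)%:R) / 2) * ((i == a) && (j == c))%:R)
  / (p%:R * q%:R).

Section TentBump.
Variables (R : realFieldType) (p q a b c : nat) (K e : R).
Hypotheses (a_in : (0 < a < p)%N) (b_in : (0 < b < q)%N) (c_in : (0 < c < q)%N).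
Hypotheses (K_ge0 : 0 <= K) (e_in : 0 <= e <= 1).
Local Notation x := (@tent_bump R p q a b c K e).
Local Notation E := (K * p%:R * (tent q b c)%:R).

Let pq_gt0 : 0 < p%:R * q%:R :> R.
Proof. by rewrite mulr_gt0 // ltr0n; lia. Qed.

Let E_ge0 : 0 <= E. Proof. by rewrite !mulr_ge0 ?ler0n. Qed.

Let raise_ge0 : 0 <= e * (E / 2).
Proof. by case/andP: e_in => e_ge0 _; rewrite mulr_ge0 ?divr_ge0 ?ler0n. Qed.

(** The tents vanish at both ends and [(a, c)] is interior, so the border keeps the values of
    ij/(pq). *)
Lemma tent_bump_boundary : quasi_copula_boundary p q x.
Proof.
have p_neq0 : p%:R != 0 :> R by rewrite pnatr_eq0; lia.
have q_neq0 : q%:R != 0 :> R by rewrite pnatr_eq0; lia.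
move=> i j le_i le_j; split; rewrite /tent_bump.
- have -> : (0%N == a) = false by lia.
  by rewrite tent0 /=; field; rewrite p_neq0 q_neq0.
- have -> : (p == a) = false by lia.
  by rewrite tent_end /=; [field; rewrite p_neq0 q_neq0 | lia].
- have -> : (0%N == c) = false by lia.
  by rewrite tent0 andbF /=; field; rewrite p_neq0 q_neq0.
have -> : (q == c) = false by lia.
by rewrite tent_end ?andbF /=; [field; rewrite p_neq0 q_neq0 | lia].
Qed.

Lemma tent_bump_col j : convex_seq p (x^~ j).
Proof.
move=> i lt_i; have ap : (a < p)%N by lia.
have := tent_second_difference R ap lt_i; rewrite natrM.
set t0 := (tent p a i)%:R; set t1 := (tent p a i.+1)%:R.
set t2 := (tent p a i.+2)%:R => tE.
have [->|/negPf neq_jc] := eqVneq j c.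
  have -> : x i c + x i.+2 c - 2 * x i.+1 c =
      (E * (i.+1 == a)%:R + e * (E / 2) * ((i == a)%:R + (i.+2 == a)%:R
        - 2 * (i.+1 == a)%:R)) / (p%:R * q%:R).
    rewrite /tent_bump -/t0 -/t1 -/t2 eqxx !andbT -!natr1.
    have -> : t0 = 2 * t1 - t2 - p%:R * (i.+1 == a)%:R by lra.
    ring.
  apply: divr_ge0; last exact: ltW.
  (* At [a] the kink [E] minus twice the raise [e * (E / 2)] leaves this slack; at other positions
     the raise enters with a nonnegative sign. *)
  have slack_ge0 : 0 <= (1 - e) * E.
    by case/andP: e_in => _ e_le1; rewrite mulr_ge0 ?subr_ge0.
  have [eq_ia|_] := eqVneq i.+1 a.
    have -> : (i == a) = false by lia.
    have -> : (i.+2 == a) = false by lia.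
    rewrite /=; lra.
  by rewrite mulr0 add0r mulr_ge0 // mulr0 subr0 addr_ge0 ?ler0n.
have -> : x i j + x i.+2 j - 2 * x i.+1 j =
    K * (tent q b j)%:R * (p%:R * (i.+1 == a)%:R) / (p%:R * q%:R).
  rewrite /tent_bump -/t0 -/t1 -/t2 neq_jc !andbF -!natr1.
  have -> : t0 = 2 * t1 - t2 - p%:R * (i.+1 == a)%:R by lra.
  ring.
by apply: divr_ge0; [rewrite !mulr_ge0 ?ler0n | exact: ltW].
Qed.

Lemma tent_bump_rowE i j : (j.+2 <= q)%N ->
  x i j + x i j.+2 - 2 * x i j.+1 =
    (K * (tent p a i)%:R * (q%:R * (j.+1 == b)%:R)
     + e * (E / 2) * (i == a)%:R
       * ((j == c)%:R + (j.+2 == c)%:R - 2 * (j.+1 == c)%:R)) / (p%:R * q%:R).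
Proof.
move=> lt_j; have bq : (b < q)%N by lia.
have := tent_second_difference R bq lt_j; rewrite natrM.
rewrite /tent_bump -!mulnb !natrM -!natr1.
set t0 := (tent q b j)%:R; set t1 := (tent q b j.+1)%:R.
set t2 := (tent q b j.+2)%:R => tE.
have -> : t0 = 2 * t1 - t2 - q%:R * (j.+1 == b)%:R by lra.
ring.
Qed.

(** The kink at [b] contributes nonnegatively, and a raised entry lowers only the second difference
    centred at it, a case the disjunction excludes unless [e = 0]. *)
Lemma tent_bump_row i j : (j.+2 <= q)%N ->
  e = 0 \/ (i, j.+1) != (a, c) -> 0 <= x i j + x i j.+2 - 2 * x i j.+1.
Proof.
move=> lt_j e0_or; rewrite tent_bump_rowE //.
apply: divr_ge0; last exact: ltW.
apply: addr_ge0; first by rewrite !mulr_ge0 ?ler0n.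
case: e0_or => [->|]; first by rewrite !mul0r.
rewrite xpair_eqE; case: (i == a) => /= [/negPf->|_]; last by rewrite mulr0 mul0r.
by rewrite mulr1 mulr0 subr0 mulr_ge0 // addr_ge0 ?ler0n.
Qed.

(** The kink of the row sits at [b], away from [c], so only the raise remains: the value is
    -eE/(pq). *)
Lemma tent_bump_row_lt0 j : 0 < K -> 0 < e -> b != c -> j.+1 = c ->
  x a j + x a j.+2 - 2 * x a j.+1 < 0.
Proof.
move=> K0 e0 neq_bc jc; have lt_j : (j.+2 <= q)%N by lia.
rewrite tent_bump_rowE // jc eqxx [c == b]eq_sym (negPf neq_bc) eqxx.
have -> : (j == c) = false by lia.
have -> : (c.+1 == c) = false by lia.
have tc : 0 < (tent q b c)%:R :> R by rewrite ltr0n tent_gt0.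
have p_gt0 : 0 < p%:R :> R by rewrite ltr0n; lia.
have eE : 0 < e * E by rewrite !mulr_gt0.
rewrite pmulr_llt0 ?invr_gt0 //=; lra.
Qed.

(** The product contributes 1 to the numerator, the tents take away at most 1, and the raise can
    only help. *)
Lemma tent_bump_first :
  K * (tent p a 1)%:R * (tent q b 1)%:R <= 1 -> 0 <= x 1%N 1%N.
Proof.
move=> h; apply: divr_ge0; last exact: ltW.
by have := raise_ge0; case: (_ && _) => /=; lra.
Qed.

Lemma tent_bump_last :
  K * (tent p a p.-1)%:R * (tent q b q.-1)%:R <= 1 ->
  ((p.-1)%:R * (q.-1)%:R - 1) / (p%:R * q%:R) <= x p.-1 q.-1.
Proof.
move=> h; rewrite ler_pM2r ?invr_gt0 //.
by have := raise_ge0; case: (_ && _) => /=; lra.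
Qed.

End TentBump.

(** * Irredundancy *)

Lemma row_convexity_irredundant (R : realFieldType) (p q a c : nat) :
  (0 < a < p)%N -> (0 < c < q)%N -> (2 < q)%N ->
  exists x : nat -> nat -> R,
    [/\ quasi_copula_boundary p q x,
        0 <= x 1%N 1%N,
        ((p.-1)%:R * (q.-1)%:R - 1) / (p%:R * q%:R) <= x p.-1 q.-1,
        forall j, convex_seq p (x^~ j) &
        (forall i j, (j.+2 <= q)%N -> (i, j.+1) != (a, c) ->
          0 <= x i j + x i j.+2 - 2 * x i j.+1) /\
        (forall j, j.+1 = c -> x a j + x a j.+2 - 2 * x a j.+1 < 0)].
Proof.
(* Any interior column other than [c] would do; one exists because [2 < q]. *)
move=> a_in c_in q2; pose b := if c == 1%N then 2%N else 1%N.
have b_in : (0 < b < q)%N by rewrite /b; case: ifP; lia.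
have neq_bc : b != c by rewrite /b; case: ifP; lia.
(* By [tent_le] this [K] keeps the subtracted term at most 1 everywhere, in particular at both
   corners. *)
pose K : R := ((p * p) * (q * q))%:R^-1.
have K_gt0 : 0 < K by rewrite invr_gt0 ltr0n !muln_gt0; lia.
have K_ge0 := ltW K_gt0.
have K_le i j : (i <= p)%N -> (j <= q)%N ->
    K * (tent p a i)%:R * (tent q b j)%:R <= 1.
  move=> le_i le_j; rewrite -mulrA -natrM mulrC ler_pdivrMr ?mul1r; last first.
    by rewrite ltr0n !muln_gt0; lia.
  by rewrite ler_nat leq_mul ?tent_le.
have e_in : 0 <= (1 : R) <= 1 by rewrite ler01 lexx.
exists (tent_bump p q a b c K 1); split.
- exact: tent_bump_boundary.
- by apply: tent_bump_first => //; apply: K_le; lia.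
- by apply: tent_bump_last => //; apply: K_le; lia.
- by move=> j; apply: tent_bump_col.
split=> [i j lt_j neq|j jc]; last exact: tent_bump_row_lt0.
by apply: tent_bump_row => //; right.
Qed.

Section MatrixOfFunction.
Variables (R : realFieldType) (p q : nat) (x : nat -> nat -> R).
Let X : 'M[R]_(p.+1, q.+1) := \matrix_(i, j) x i j.

Lemma entry_matrix i j : (i <= p)%N -> (j <= q)%N -> entry X i j = x i j.
Proof. by move=> le_i le_j; rewrite /entry mxE !inordK. Qed.

Lemma boundary_matrix : quasi_copula_boundary p q x -> boundary X.
Proof. by move=> bx i j le_i le_j; rewrite !entry_matrix //; apply: bx. Qed.

Lemma satisfies_first_matrix : (0 < p)%N -> (0 < q)%N ->
  satisfies X (v_inequality R (inl true : v_index p q)) <-> 0 <= x 1%N 1%N.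
Proof. by move=> p0 q0; rewrite /satisfies /= entry_matrix. Qed.

Lemma satisfies_last_matrix :
  satisfies X (v_inequality R (inl false : v_index p q)) <->
  ((p.-1)%:R * (q.-1)%:R - 1) / (p%:R * q%:R) <= x p.-1 q.-1.
Proof. by rewrite /satisfies /= entry_matrix ?leq_pred. Qed.

Lemma satisfies_row_matrix (i : 'I_p.-1) (j : 'I_q.-1) :
  satisfies X (v_inequality R (inr (inl (i, j)) : v_index p q)) <->
  0 <= x i.+1 j + x i.+1 j.+2 - 2 * x i.+1 j.+1.
Proof.
have ? := ltn_ord i; have ? := ltn_ord j.
by rewrite /satisfies /= !entry_matrix //; lia.
Qed.

Lemma satisfies_col_matrix (i : 'I_p.-1) (j : 'I_q.-1) :
  satisfies X (v_inequality R (inr (inr (i, j)) : v_index p q)) <->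
  0 <= x i j.+1 + x i.+2 j.+1 - 2 * x i.+1 j.+1.
Proof.
have ? := ltn_ord i; have ? := ltn_ord j.
by rewrite /satisfies /= !entry_matrix //; lia.
Qed.

End MatrixOfFunction.

Lemma irredundant_v_inequality (R : realFieldType) (p q : nat) :
  (2 < p)%N -> (2 < q)%N ->
  irredundant (@boundary R p q) (@v_inequality R p q).
Proof.
move=> p2 q2.
have pq_gt0 : 0 < p%:R * q%:R :> R by rewrite mulr_gt0 // ltr0n; lia.
have K_ge0 : 0 <= (1 : R) by exact: ler01.
have e_in : 0 <= (0 : R) <= 1 by rewrite lexx ler01.
have pq1 : 1 < (p.-1)%:R * (q.-1)%:R :> R by rewrite -natrM ltr1n; nia.
move=> [[]|[[i0 j0]|[i0 j0]]].
(* As [e = 0], nothing is raised and [c = 1] is arbitrary. The tents multiply to (p-1)(q-1) > 1 at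
   (1,1), but only to 1 at the opposite corner. *)
- pose x := tent_bump p q 1 1 1 (1 : R) 0.
  exists (\matrix_(i, j) x i j); split.
  + by apply/boundary_matrix/tent_bump_boundary; lia.
  + move=> [[]|[[i j]|[i j]]] // _.
    * apply/satisfies_last_matrix; apply: tent_bump_last => //; try lia.
      rewrite mul1r -natrM lern1 /tent; do 2 case: ifP; nia.
    * apply/satisfies_row_matrix; have := ltn_ord j => ?.
      by apply: tent_bump_row => //; [lia.. | left].
    apply/satisfies_col_matrix; have := ltn_ord i => ?.
    by apply: tent_bump_col => //; lia.
  move/satisfies_first_matrix => /(_ ltac:(lia) ltac:(lia)).
  rewrite /x /tent_bump !tent_apex !mul0r addr0 !mul1r !mul1n !subn1.
  by rewrite pmulr_lge0 ?invr_gt0 //; lra.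
(* Now the numerator at (p-1,q-1) is 0, below the required (p-1)(q-1) - 1. *)
- pose x := tent_bump p q p.-1 q.-1 1 (1 : R) 0.
  exists (\matrix_(i, j) x i j); split.
  + by apply/boundary_matrix/tent_bump_boundary; lia.
  + move=> [[]|[[i j]|[i j]]] // _.
    * apply/satisfies_first_matrix; [lia.. |].
      apply: tent_bump_first => //; try lia.
      rewrite mul1r -natrM lern1 /tent; do 2 case: ifP; nia.
    * apply/satisfies_row_matrix; have := ltn_ord j => ?.
      by apply: tent_bump_row => //; [lia.. | left].
    apply/satisfies_col_matrix; have := ltn_ord i => ?.
    by apply: tent_bump_col => //; lia.
  move/satisfies_last_matrix; rewrite /x /tent_bump !tent_apex.
  have -> : (p - p.-1 = 1)%N by lia.
  have -> : (q - q.-1 = 1)%N by lia.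
  by rewrite ler_pM2r ?invr_gt0 // !muln1; lra.
- have ? := ltn_ord i0; have ? := ltn_ord j0.
  have [||x [bx x11 xlast cols [rows row0]]] :=
    @row_convexity_irredundant R p q i0.+1 j0.+1 _ _ q2; [lia.. |].
  exists (\matrix_(i, j) x i j); split; first exact: boundary_matrix.
    move=> [[]|[[i j]|[i j]]] neq.
    + by apply/satisfies_first_matrix => //; lia.
    + exact/satisfies_last_matrix.
    + apply/satisfies_row_matrix; have ? := ltn_ord j; apply: rows; first lia.
      by apply: contra neq => /eqP[/val_inj-> /val_inj->].
    + by apply/satisfies_col_matrix; have ? := ltn_ord i; apply: cols; lia.
  move/satisfies_row_matrix; have := row0 j0 erefl; lra.
(* Column convexity is row convexity of the transpose, with [p] and [q] exchanged. *)
have ? := ltn_ord i0; have ? := ltn_ord j0.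
have [||x [bx x11 xlast cols [rows row0]]] :=
  @row_convexity_irredundant R q p j0.+1 i0.+1 _ _ p2; [lia.. |].
exists (\matrix_(i, j) x j i); split.
- exact: (boundary_matrix (quasi_copula_boundary_swap bx)).
- move=> [[]|[[i j]|[i j]]] neq.
  + by apply/(@satisfies_first_matrix _ _ _ (fun i j => x j i)) => //; lia.
  + apply/(@satisfies_last_matrix _ _ _ (fun i j => x j i)).
    by rewrite [_ * (q.-1)%:R]mulrC [p%:R * _]mulrC.
  + apply/(@satisfies_row_matrix _ _ _ (fun i j => x j i)).
    by have ? := ltn_ord j; apply: cols; lia.
  apply/(@satisfies_col_matrix _ _ _ (fun i j => x j i)).
  have ? := ltn_ord i; apply: rows; first lia.
  by apply: contra neq => /eqP[/val_inj-> /val_inj->].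
move/(@satisfies_col_matrix _ _ _ (fun i j => x j i)).
have := row0 i0 erefl; lra.
Qed.

Theorem theorem4 (R : realFieldType) (p q : nat) (hp : (0 < p)%N)
    (hq : (0 < q)%N) :
  [/\ H_representation (@boundary R p q) (@CDQ R p q) (@v_inequality R p q),
      #|v_index p q| = (2 * ((p - 1) * (q - 1) + 1))%N
    & (2 < p)%N -> (2 < q)%N ->
      irredundant (@boundary R p q) (@v_inequality R p q)].
Proof.
split; [exact: H_representation_CDQ | | exact: irredundant_v_inequality].
rewrite !card_sum !card_prod !card_ord card_bool; lia.
Qed.
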